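(* Let $\Gamma$ be an ordinary graph with node set $[n]=\{1,\dots,n\}$ and let $P = [0,1]^n$. The closed and open Ehrhart quasipolynomials of $(P,\mathcal{H}[\Gamma])$ satisfy $$(-1)^n E_{P,\mathcal{H}[\Gamma]}(-t) = E^\circ_{P^\circ,\mathcal{H}[\Gamma]}(t) = \chi_\Gamma(t-1).$$
   Context: An ordinary graph is a finite graph whose edges are links (two distinct endpoints) and loops (two coinciding endpoints); multiple edges are permitted. $\mathcal{H}[\Gamma]=\{h_{ij}: ij \text{ an edge of }\Gamma\}$, where $h_{ij}=\{x\in\mathbb{R}^n: x_i=x_j\}$; for a loop, $h_{ii}=\mathbb{R}^n$ is the degenerate hyperplane, in which case there are no regions. A proper coloring of $\Gamma$ in $c$ colors is a function $x:[n]\to\{1,\dots,c\}$ with $x_i\ne x_j$ whenever there is an edge $ij$; the chromatic polynomial $\chi_\Gamma$ is the polynomial whose value at each integer $c\ge0$ is the number of proper colorings in $c$ colors. A closed region of $(P,\mathcal{H})$ is the closure of a connected component of $P\setminus\bigcup\mathcal{H}$. For $x\in\mathbb{R}^n$, $m_{P,\mathcal{H}}(x)$ is the number of closed regions of $(P,\mathcal{H})$ containing $x$ if $x\in P$, and $0$ otherwise. $P^\circ$ is the interior of $P$. For positive integers $t$, $$E_{P,\mathcal{H}}(t)=\sum_{x\in t^{-1}\mathbb{Z}^n}m_{P,\mathcal{H}}(x),\qquad E^\circ_{P^\circ,\mathcal{H}}(t)=\#\bigl(t^{-1}\mathbb{Z}^n\cap[P^\circ\setminus\textstyle\bigcup\mathcal{H}]\bigr).$$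 These are quasipolynomials in $t$ (functions $\sum_i c_i(t)t^i$ with $c_i$ periodic in the integer $t$), and are extended as such to all integers; this gives meaning to $E_{P,\mathcal{H}[\Gamma]}(-t)$. *)

(* Defs.v *)
From HB Require Import structures.
From mathcomp Require Import all_boot all_order all_algebra.
From mathcomp Require Import finmap zify.
From mathcomp Require Import all_classical all_reals all_analysis.
Set Implicit Arguments.
Unset Strict Implicit.
Unset Printing Implicit Defensive.
Import Order.TTheory GRing.Theory Num.Theory.
Import numFieldNormedType.Exports.
Local Open Scope classical_set_scope.
Local Open Scope ring_scope.

(* The order of the two endpoints of an edge is immaterial: every notion below
   is symmetric in them.  An edge with equal endpoints is a loop. *)
Record ordinary_graph (n : nat) := OrdinaryGraph {
  edge : finType;
  ends : edge -> 'I_n * 'I_n }.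

Definition hyperplane (R : realType) (n : nat) (i j : 'I_n) : set 'rV[R]_n :=
  [set x | x ord0 i = x ord0 j].
Arguments hyperplane R {n} i j.

Definition graph_arrangement (R : realType) (n : nat) (G : ordinary_graph n) :
    set (set 'rV[R]_n) :=
  [set h | exists e : edge G, h = hyperplane R (ends e).1 (ends e).2].
Arguments graph_arrangement R {n} G.

Definition proper_colorings (n : nat) (G : ordinary_graph n) (c : nat) :
    {set {ffun 'I_n -> 'I_c}} :=
  [set x : {ffun 'I_n -> 'I_c} |
    [forall e : edge G, x (ends e).1 != x (ends e).2]]%SET.

Definition is_chromatic_poly (n : nat) (G : ordinary_graph n) (p : {poly rat}) :
    Prop :=
  forall c : nat, p.[c%:R] = #|proper_colorings G c|%:R.

Definition chromatic_poly (n : nat) (G : ordinary_graph n) : {poly rat} :=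
  xget 0 [set p | is_chromatic_poly G p].

Definition unit_cube (R : realType) (n : nat) : set 'rV[R]_n :=
  [set x | forall i, 0 <= x ord0 i <= 1].
Arguments unit_cube : clear implicits.

(* [fset_set] is the empty set on infinite sets, and [\sum_(x \in A) F x] is 0
   when [F] has infinite support in [A]; for the cube and a finite
   arrangement of hyperplanes, neither case occurs. *)
Definition closed_regions (R : realType) (n : nat) (P : set 'rV[R]_n)
    (H : set (set 'rV[R]_n)) : set (set 'rV[R]_n) :=
  let U := P `\` \bigcup_(h in H) h in
  [set closure (connected_component U x) | x in U].

Definition multiplicity (R : realType) (n : nat) (P : set 'rV[R]_n)
    (H : set (set 'rV[R]_n)) (x : 'rV[R]_n) : nat :=
  if x \in P then #|` fset_set [set C | closed_regions P H C /\ C x]| else 0%N.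

Definition scaled_lattice (R : realType) (n t : nat) : set 'rV[R]_n :=
  [set x | forall i, exists z : int, x ord0 i = t%:R^-1 * z%:~R].
Arguments scaled_lattice : clear implicits.

Definition closed_count (R : realType) (n : nat) (P : set 'rV[R]_n)
    (H : set (set 'rV[R]_n)) (t : nat) : nat :=
  \sum_(x \in scaled_lattice R n t) multiplicity P H x.

Definition open_count (R : realType) (n : nat) (Q : set 'rV[R]_n)
    (H : set (set 'rV[R]_n)) (t : nat) : nat :=
  #|` fset_set (scaled_lattice R n t `&` (Q `\` \bigcup_(h in H) h))|.

Definition quasipolynomial (q : int -> rat) : Prop :=
  exists (d : nat) (c : 'I_d -> int -> rat),
    (forall i, exists2 p : nat, (0 < p)%N & forall t, c i (t + p%:Z) = c i t) /\
    (forall t, q t = \sum_(i < d) c i t * t%:~R ^+ i).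

Definition quasi_extends (f : nat -> nat) (q : int -> rat) : Prop :=
  quasipolynomial q /\ forall t : nat, (0 < t)%N -> q t%:Z = (f t)%:R.

Definition quasi_extension (f : nat -> nat) : int -> rat :=
  xget (fun=> 0) [set q | quasi_extends f q].

Definition closed_ehrhart (R : realType) (n : nat) (P : set 'rV[R]_n)
    (H : set (set 'rV[R]_n)) : int -> rat :=
  quasi_extension (closed_count P H).

Definition open_ehrhart (R : realType) (n : nat) (Q : set 'rV[R]_n)
    (H : set (set 'rV[R]_n)) : int -> rat :=
  quasi_extension (open_count Q H).

(* Uniqueness: the choices made by [chromatic_poly] and [quasi_extension] are
   immaterial. *)

Lemma poly_eq0_nat (p : {poly rat}) (k0 : nat) :
  (forall k : nat, (k0 <= k)%N -> p.[k%:R] = 0) -> p = 0.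
Proof.
move=> pk; apply/eqP/contraT => p_neq0.
have := @max_poly_roots _ p [seq i%:R | i <- iota k0 (size p)] p_neq0.
rewrite size_map size_iota ltnn; apply.
  by apply/allP => _ /mapP[i + ->]; rewrite mem_iota => /andP[/pk + _];
    rewrite rootE => ->.
by rewrite map_inj_uniq ?iota_uniq// => i j /eqP; rewrite eqr_nat => /eqP.
Qed.

Lemma chromatic_poly_unique (n : nat) (G : ordinary_graph n) (p q : {poly rat}) :
  is_chromatic_poly G p -> is_chromatic_poly G q -> p = q.
Proof.
move=> Gp Gq; apply/eqP; rewrite -subr_eq0; apply/eqP.
by apply: (@poly_eq0_nat _ 0) => k _; rewrite hornerD hornerN Gp Gq subrr.
Qed.

Lemma quasipolynomial_progression (q : int -> rat) : quasipolynomial q ->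
  exists2 p : nat, (0 < p)%N &
    forall (t : int) (m : nat), exists r : {poly rat},
      forall k : nat, q (t + (k * (m * p))%N%:Z) = r.[k%:R].
Proof.
move=> [d [c [cper qE]]].
have /choice[p pP] : forall i : 'I_d, exists p : nat,
    (0 < p)%N /\ forall t, c i (t + p%:Z) = c i t.
  by move=> i; have [p p0 cp] := cper i; exists p.
have cmul i t k : c i (t + (k * p i)%N%:Z) = c i t.
  elim: k => [|k IH]; first by rewrite mul0n addr0.
  by rewrite mulSn addnC PoszD addrA (pP i).2 IH.
exists (\prod_i p i)%N; first by apply: prodn_gt0 => i; exact: (pP i).1.
move=> t m; set N := (m * \prod_i p i)%N.
exists (\sum_(i < d) c i t *: ((t%:~R)%:P + N%:R *: 'X) ^+ i) => k.
rewrite qE horner_sum; apply: eq_bigr => i _.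
have -> : (k * N = (k * (m * \prod_(j | j != i) p j)) * p i)%N.
  by rewrite /N [in LHS](bigD1 i)//=; set Q := bigop.body _ _ _; lia.
rewrite cmul hornerZ horner_exp hornerD hornerC hornerZ hornerX.
congr (_ * _ ^+ _); rewrite intrD; congr (_ + _).
rewrite -pmulrn -natrM; congr (_%:R).
by rewrite /N [in RHS](bigD1 i)//=; set Q := bigop.body _ _ _; lia.
Qed.

Lemma quasi_extension_unique (f : nat -> nat) (q r : int -> rat) :
  quasi_extends f q -> quasi_extends f r -> q = r.
Proof.
move=> [/quasipolynomial_progression[p p0 qP] qf].
move=> [/quasipolynomial_progression[p' p'0 rP] rf].
apply/funext => t.
have [a aE] := qP t p'; have [b bE] := rP t p.
rewrite (mulnC p p') in bE.
have ab0 : a - b = 0.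
  apply: (@poly_eq0_nat _ (`|t|%N).+1) => k tk.
  rewrite hornerD hornerN -aE -bE.
  have N0 : (0 < p' * p)%N by rewrite muln_gt0 p0 p'0.
  have : 0 < t + (k * (p' * p))%N%:Z.
    have : (k <= k * (p' * p))%N by rewrite leq_pmulr.
    move: (k * _)%N => K; lia.
  case: (t + _) => // s s0.
  by rewrite qf// rf// subrr.
have := aE 0%N; have := bE 0%N.
by rewrite mul0n addr0 => -> ->; move/eqP: ab0; rewrite subr_eq0 => /eqP->.
Qed.

(* Main.v *)
Require Import Defs.
From mathcomp Require Import all_boot all_order all_algebra.
From mathcomp Require Import finmap zify ring lra.
From mathcomp Require Import all_classical all_reals all_analysis.
Set Implicit Arguments.
Unset Strict Implicit.
Unset Printing Implicit Defensive.
Import Order.TTheory GRing.Theory Num.Theory.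
Import numFieldNormedType.Exports.
Local Open Scope ring_scope.

(** Both counts are counts of colorings.  A point of the open cube with
coordinates in (1/t)Z avoids the arrangement exactly when its numerators
1, ..., t - 1 color the graph properly; hence the open count at t is the
chromatic polynomial at t - 1 ([open_countE]).

For the closed count, a region is determined by the direction of the
inequality between the coordinates along each edge.  Along a connected set
that avoids the arrangement no coordinate difference on an edge changes sign,
and points with the same directions are joined by a segment that avoids the
arrangement, so the regions are the nonempty sets with prescribed directions
([connected_component_region]), and closing one of them relaxes the strict
inequalities ([closure_region]).  The possible systems of directions are the
acyclic orientations, here called patterns.  So the closed count at t is the
number of pairs of an arbitrary coloring of the nodes by 0, ..., t and an
acyclic orientation along which colors weakly increase ([closed_countE]).

It remains to prove the theorem of Stanley that the number of compatible pairs
with c colors is (-1)^n chi(-c) ([compatible_pairs_reciprocity]).  Let P_S(c) be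
the number of proper colorings of the subgraph induced on S, and F_S(c) the
number of compatible pairs on it.  Removing the top color class gives

  P_S(c+1) = sum of P_(S - T)(c) over the independent subsets T of S

([proper_countS]).  This shows by induction on S that P_S is a polynomial, and
then the recurrence holds at every rational number in place of c.  The
compatible pairs satisfy the inverse recurrence

  F_S(c) = sum of (-1)^|T| F_(S - T)(c+1) over the independent subsets T of S

([compatible_pairs_rec]).  Indeed a pair on S - T extends to S by giving T the
top color and directing all edges towards it, and what is obtained are the
pairs on S for which T consists of sinks of top color; the alternating sum over
T keeps only the pairs without such a sink.  These are the pairs that do not
use the top color, for otherwise a maximal node of the top color class would be
such a sink.  Comparing the two recurrences at -c-1 gives
F_S(c) = (-1)^|S| P_S(-c) by induction on c and |S|.

A quasipolynomial is determined by its values at positive integers, so these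
polynomial formulas hold for the extended functions. *)

(** * Counting in finite sets *)

Section FiniteSets.
Import mathcomp.boot.fintype mathcomp.boot.finset.

Lemma card_bij (X Y : finType) (A : {set X}) (B : {set Y}) (f : X -> Y)
    (g : Y -> X) :
  {in A, forall a, f a \in B /\ g (f a) = a} ->
  {in B, forall b, g b \in A /\ f (g b) = b} -> #|A| = #|B|.
Proof.
move=> fA gB; have <- : f @: A = B.
  apply/setP => b; apply/imsetP/idP => [[a /fA[fa _] ->]//|/gB[gA gK]].
  by exists (g b).
by rewrite card_in_imset// => a a' /fA[_ {2}<-] /fA[_ {2}<-] ->.
Qed.

(** Adding or removing a fixed element of K is a sign-reversing involution on
    the subsets of K. *)
Lemma alternating_sum_subsets (R : pzRingType) (V : finType) (K : {set V}) :
  \sum_(T : {set V} | T \subset K) (-1) ^+ #|T| = (K == set0)%:R :> R.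
Proof.
have [->|/set0Pn[v vK]] := eqVneq K set0.
  rewrite (big_pred1 set0) ?cards0// => T; exact: subset0.
rewrite (bigID (fun T : {set V} => v \in T))/=.
rewrite (reindex_onto (fun T => v |: T) (fun T => T :\ v)) /=; last first.
  by move=> T /andP[_ vT]; rewrite setD1K.
rewrite -[X in X + _]opprK -sumrN addrC; apply/eqP; rewrite subr_eq0; apply/eqP.
apply: eq_big => [T|T /andP[_ vT]]; last by rewrite cardsU1 vT exprS mulN1r opprK.
rewrite subUset sub1set vK setU11 /= andbT; congr (_ && _).
apply/idP/eqP => [vT|<-]; last by rewrite setD11.
by rewrite setU1K.
Qed.


End FiniteSets.

(** * Indefinite sums of polynomials *)

Definition has_antidifference (p : {poly rat}) : Prop :=
  exists q : {poly rat}, forall c : nat, q.[c.+1%:R] = q.[c%:R] + p.[c%:R].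

Lemma has_antidifference_sum (I : Type) (r : seq I) (P : pred I) (a : I -> rat)
    (F : I -> {poly rat}) :
  (forall i, P i -> has_antidifference (F i)) ->
  has_antidifference (\sum_(i <- r | P i) a i *: F i).
Proof.
move=> sF; elim/big_ind: _ => [|p q [p' pE] [q' qE]|i /sF[q qE]].
- by exists 0 => c; rewrite !horner0 addr0.
- by exists (p' + q') => c; rewrite !hornerD pE qE addrACA.
- by exists (a i *: q) => c; rewrite !hornerZ qE mulrDr.
Qed.

(** The difference of X^(k+1) is (k+1) X^k plus a combination of lower powers,
    whose antidifferences are available by induction. *)
Lemma has_antidifference_Xn k : has_antidifference 'X^k.
Proof.
elim/ltn_ind: k => k IH.
have [q qE] : has_antidifference (\sum_(i < k) 'C(k.+1, i)%:R *: 'X^i).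
  by apply: has_antidifference_sum => i _; exact: IH.
exists (k.+1%:R^-1 *: ('X^(k.+1) - q)) => c.
apply: (@mulfI _ k.+1%:R); first by rewrite pnatr_eq0.
rewrite mulrDr !hornerZ !mulrA divff ?pnatr_eq0// !mul1r.
rewrite !hornerD !hornerN !hornerXn qE.
rewrite -[c.+1%:R]natr1 exprD1n big_ord_recr /= binn big_ord_recr /= binSn.
rewrite horner_sum mulr1n.
rewrite (eq_bigr (fun i : 'I_k => ('C(k.+1, i)%:R *: 'X^i : {poly rat}).[c%:R])); last first.
  by move=> i _; rewrite hornerZ hornerXn mulr_natl.
rewrite mulr_natl; set A := \sum_(i < k) _.
by ring.
Qed.

Lemma has_antidifferenceP (p : {poly rat}) : has_antidifference p.
Proof.
rewrite -[p]coefK poly_def.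
by apply: has_antidifference_sum => i _; exact: has_antidifference_Xn.
Qed.

(** * Proper colorings, compatible pairs and Stanley reciprocity *)

Section Colorings.
Import mathcomp.boot.fintype mathcomp.boot.finset.
Variables (V : finType) (adj : rel V).
Hypothesis adj_sym : symmetric adj.
Implicit Types (S T K : {set V}) (m c : nat).

Definition proper_on (C : eqType) S (y : V -> C) : bool :=
  [forall u in S, forall v in S, adj u v ==> (y u != y v)].

Definition independent T : bool :=
  [forall u in T, forall v in T, ~~ adj u v].

Lemma proper_onP (C : eqType) S (y : V -> C) :
  reflect (forall u v, u \in S -> v \in S -> adj u v -> y u != y v)
          (proper_on S y).
Proof.
apply: (iffP forall_inP) => [h u v uS vS uv|h u uS].
  by have /forall_inP/(_ v vS)/implyP := h u uS; exact.
by apply/forall_inP => v vS; apply/implyP; exact: h.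
Qed.

Lemma independentP T :
  reflect (forall u v, u \in T -> v \in T -> ~~ adj u v) (independent T).
Proof.
apply: (iffP forall_inP) => [h u v uT vT|h u uT].
  by have /forall_inP := h u uT; exact.
by apply/forall_inP => v vT; exact: h.
Qed.

(** The colors 0, ..., c - 1 are taken in the fixed type ['I_m.+1], so that the
    number of colors and the set of colored nodes may vary without a change of
    type; the value [ord0] off [S] makes the partial coloring unique. *)
Definition colorings m S c : {set {ffun V -> 'I_m.+1}} :=
  [set x : {ffun V -> 'I_m.+1} |
    [forall v, if v \in S then x v < c else x v == ord0]]%N.

Lemma coloringsP m S c (x : {ffun V -> 'I_m.+1}) :
  reflect ((forall v, v \in S -> x v < c)%N /\ (forall v, v \notin S -> x v = ord0))
          (x \in colorings m S c).
Proof.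
rewrite inE; apply: (iffP forallP) => [h|[h1 h2] v].
  split=> v vS; have := h v; rewrite ?vS ?(negPf vS)//.
  by move=> /eqP.
by case: ifPn => [/h1|/h2 ->].
Qed.

Definition proper_count m S c : nat :=
  #|[set x in colorings m S c | proper_on S x]|.

(** Deletion of the top color class [T], where [T] may be empty: the nodes of top
    color are independent, and giving the top color to an independent set extends
    a proper coloring of the complement. *)
Lemma proper_countS m S c : (c <= m)%N ->
  proper_count m S c.+1 =
  (\sum_(T : {set V} | (T \subset S) && independent T) proper_count m (S :\: T) c)%N.
Proof.
move=> cm; pose top (x : {ffun V -> 'I_m.+1}) := [set v in S | x v == c :> nat].
have inordc : (inord c : 'I_m.+1) = c :> nat by rewrite inordK.
rewrite /proper_count -sum1_card.
rewrite (partition_big top (fun T : {set V} => (T \subset S) && independent T)) /=; last first.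
  move=> x; rewrite inE => /andP[_ /proper_onP xS].
  apply/andP; split; first by apply/subsetP => v; rewrite inE => /andP[].
  apply/independentP => u v; rewrite !inE => /andP[uS /eqP xu] /andP[vS /eqP xv].
  by apply/negP => /(xS _ _ uS vS); rewrite -val_eqE/= xu xv eqxx.
apply: eq_bigr => T /andP[TS /independentP Tind]; rewrite sum1_card.
transitivity #|[set x in colorings m S c.+1 | proper_on S x && (top x == T)]|.
  apply: eq_card => x; rewrite [RHS]inE andbA.
  transitivity ((x \in [set x in colorings m S c.+1 | proper_on S x]) && (top x == T)) => //.
  by congr (_ && _); rewrite inE.
apply: (@card_bij _ _ _ _
  (fun x : {ffun V -> 'I_m.+1} => [ffun v => if v \in T then ord0 else x v])
  (fun x : {ffun V -> 'I_m.+1} => [ffun v => if v \in T then inord c else x v])) => x.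
- rewrite inE => /and3P[/coloringsP[xlt x0] /proper_onP xS /eqP topx].
  split; last first.
    apply/ffunP => v; rewrite !ffunE; case: (boolP (v \in T)) => // vT; apply/val_inj => /=.
    by move: vT; rewrite inordc -topx inE => /andP[_ /eqP].
  rewrite inE; apply/andP; split.
    apply/coloringsP; split => v; rewrite inE ffunE.
      move=> /andP[vT vS]; rewrite (negPf vT).
      have := xlt v vS; rewrite ltnS leq_eqVlt => /orP[xv|//].
      by move: vT; rewrite -topx inE vS xv.
    by rewrite negb_and negbK; case: ifP => //= _; exact: x0.
  apply/proper_onP => u v; rewrite !inE !ffunE => /andP[/negPf-> uS] /andP[/negPf-> vS].
  exact: xS.
rewrite inE => /andP[/coloringsP[xlt x0] /proper_onP xS].
have notT v : v \in T -> x v = ord0 by move=> vT; apply: x0; rewrite inE vT.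
split; last by apply/ffunP => v; rewrite !ffunE; case: (boolP (v \in T)) => // /notT.
rewrite inE andbA; apply/andP; split; last first.
  apply/eqP/setP => v; rewrite inE ffunE; case: ifPn => vT.
    by rewrite (subsetP TS)//= inordc eqxx.
  apply/negP => /andP[vS /eqP xv]; have := xlt v; rewrite inE vT vS xv ltnn.
  by move=> /(_ isT).
apply/andP; split.
  apply/coloringsP; split => v; rewrite ffunE => vS.
    case: ifPn => vT; first by rewrite inordc.
    by rewrite ltnS ltnW// xlt// inE vT.
  rewrite ifF; first by apply: x0; rewrite inE negb_and vS orbT.
  by apply: contraNF vS; exact: (subsetP TS).
have lt v : v \in S -> v \notin T -> x v != inord c.
  move=> vS vT; rewrite -val_eqE /= inordc neq_ltn; apply/orP; left.
  by apply: xlt; rewrite inE vT.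
apply/proper_onP => u v uS vS uv; rewrite !ffunE.
case: ifPn => uT; case: ifPn => vT.
- by have := Tind _ _ uT vT; rewrite uv.
- by rewrite eq_sym lt.
- exact: lt.
- by apply: xS => //; rewrite inE ?uT ?vT.
Qed.

Variable R : realDomainType.

(** The orientation of the edges inside [S] by increasing [y], as a set of
    ordered pairs; several parallel edges give one pair. *)
Definition pattern S (y : V -> R) : {set V * V} :=
  [set p | [&& p.1 \in S, p.2 \in S, adj p.1 p.2 & y p.1 < y p.2]].

(** The acyclic orientations of the subgraph induced on [S]: those which come
    from a height function. *)
Definition patterns S : {set {set V * V}} :=
  [set D | `[< exists2 y : V -> R, proper_on S y & D = pattern S y >]].

Definition compatible_pairs m S c : {set {ffun V -> 'I_m.+1} * {set V * V}} :=
  [set p | [&& p.1 \in colorings m S c, p.2 \in patterns S &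
               [forall q in p.2, p.1 q.1 <= p.1 q.2]]]%N.

Lemma compatible_pairsP m S c (x : {ffun V -> 'I_m.+1}) D :
  reflect [/\ x \in colorings m S c, exists2 y : V -> R, proper_on S y & D = pattern S y
    & forall u v, (u, v) \in D -> x u <= x v]%N ((x, D) \in compatible_pairs m S c).
Proof.
rewrite [X in reflect _ X]inE; apply: (iffP and3P) => -[/= ? h1 h2]; split => //.
- by move: h1; rewrite inE => /asboolP.
- by move=> u v uv; have /forall_inP/(_ _ uv) := h2.
- by rewrite inE; apply/asboolP.
- by apply/forall_inP => -[u v]; exact: h2.
Qed.

(** The color [c] is the top one when [c.+1] colors are in use. *)
Definition top_sinks m S c (p : {ffun V -> 'I_m.+1} * {set V * V}) : {set V} :=
  [set v in S | (p.1 v == c :> nat) && [forall w, (v, w) \notin p.2]].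

(** An edge between two of these nodes would leave one of them. *)
Lemma top_sinks_independent m S c p : p \in compatible_pairs m S c.+1 ->
  independent (top_sinks S c p).
Proof.
case: p => x D /compatible_pairsP[_ [y /proper_onP yS ->] _].
apply/independentP => u v; rewrite !inE /=.
move=> /andP[uS /andP[_ /forallP uD]] /andP[vS /andP[_ /forallP vD]].
apply/negP => uv; have := yS _ _ uS vS uv; rewrite neq_lt => /orP[yuv|yuv].
  by have := uD v; rewrite inE /= uS vS uv yuv.
by have := vD u; rewrite inE /= uS vS adj_sym uv yuv.
Qed.

(** When the top color occurs, a node of greatest height among those having it
    is a sink: an edge out of it would lead to a node of the same color and
    greater height. *)
Lemma top_sinks_eq0 m S c : (c <= m)%N ->
  [set p in compatible_pairs m S c.+1 | top_sinks S c p == set0] =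
  compatible_pairs m S c.
Proof.
move=> cm; apply/setP => -[x D]; rewrite inE.
apply/andP/compatible_pairsP => [[/compatible_pairsP[/coloringsP[xlt x0] yD xD] /eqP K0]|].
  split=> //; apply/coloringsP; split=> // v vS; rewrite ltn_neqAle -ltnS xlt// andbT.
  apply/negP => xv; case: yD => y /proper_onP yS DE.
  have [|u /andP[uS /eqP xu] umax] := @Order.TotalTheory.arg_maxP _ _ V v
    (fun v => (v \in S) && (x v == c :> nat)) y; first by rewrite vS xv.
  suff : u \in top_sinks S c (x, D) by rewrite K0 inE.
  rewrite inE /= uS xu eqxx /=; apply/forallP => w; apply/negP => uw.
  have := uw; rewrite DE inE /= => /and4P[_ wS _].
  rewrite ltNge => /negP; apply; apply: umax; rewrite wS /= eqn_leq.
  by rewrite -ltnS xlt//= -xu; exact: xD.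
move=> [/coloringsP[xlt x0] yD xD]; split.
  apply/compatible_pairsP; split=> //; apply/coloringsP; split=> // v /xlt.
  by move/ltnW.
apply/eqP/setP => v; rewrite !inE /=; apply/negP => /andP[/xlt + /andP[/eqP xv _]].
by rewrite xv ltnn.
Qed.

(** Restriction to [S :\: T] is a bijection: the removed data are determined,
    since [T] has the top color and every edge that meets [T] enters it. *)
Lemma card_compatible_pairs_sinks m S c T :
  (c <= m)%N -> T \subset S -> independent T ->
  #|[set p in compatible_pairs m S c.+1 | T \subset top_sinks S c p]| =
  #|compatible_pairs m (S :\: T) c.+1|.
Proof.
move=> cm /subsetP TS /independentP Tind.
have inordc : (inord c : 'I_m.+1) = c :> nat by rewrite inordK.
apply: (@card_bij _ _ _ _
  (fun p : {ffun V -> 'I_m.+1} * {set V * V} => ([ffun v => if v \in T then ord0 else p.1 v],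
             [set q in p.2 | (q.1 \notin T) && (q.2 \notin T)]))
  (fun p : {ffun V -> 'I_m.+1} * {set V * V} => ([ffun v => if v \in T then inord c else p.1 v],
             p.2 :|: [set q | [&& q.1 \in S :\: T, q.2 \in T & adj q.1 q.2]])))
  => -[x D].
- rewrite inE => /andP[/compatible_pairsP[/coloringsP[xlt x0] [y yS DE] xD]].
  move=> /subsetP KT; have {KT}KT v : v \in T -> (x v = c :> nat) /\ forall w, (v, w) \notin D.
    by move=> /KT; rewrite inE => /and3P[_ /eqP -> /forallP].
  split.
    apply/compatible_pairsP; split => [||u v].
    + apply/coloringsP; split => v; rewrite inE ffunE.
        by move=> /andP[/negPf-> /xlt].
      by rewrite negb_and negbK; case: ifP => //= _; exact: x0.
    + exists y.
        apply/proper_onP => u v; rewrite !inE => /andP[_ uS] /andP[_ vS].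
        by move: uS vS; apply/proper_onP.
      by apply/setP => -[u v]; rewrite DE !inE /=; 
        case: (u \in S); case: (v \in S); case: (u \in T); case: (v \in T);
          by rewrite ?andbF ?andbT.
    + by rewrite inE !ffunE /= => /and3P[uv /negPf-> /negPf->]; exact: xD.
  congr (_, _).
    apply/ffunP => v; rewrite !ffunE; case: (boolP (v \in T)) => // /KT[xv _].
    by apply/val_inj; rewrite /= inordc xv.
  apply/setP => -[u v]; rewrite !inE /=.
  case: (boolP (u \in T)) => uT /=; first by rewrite andbF (negPf ((KT _ uT).2 _)).
  case: (boolP (v \in T)) => vT /=; last by rewrite ?andbF ?andbT ?orbF.
  rewrite andbF /= DE inE /= (TS _ vT) /=.
  case: (boolP (u \in S)) => //= uS; case: (boolP (adj u v)) => //= uv.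
  have /proper_onP/(_ _ _ uS (TS _ vT) uv) := yS; rewrite neq_lt => /orP[->//|yvu].
  by have := (KT _ vT).2 u; rewrite DE inE /= uS (TS _ vT) adj_sym uv yvu.
move=> /compatible_pairsP[/coloringsP[xlt x0] [y /proper_onP yS DE] xD].
have DT u v : (u, v) \in D -> (u \notin T) && (v \notin T).
  by rewrite DE !inE /= => /and3P[/andP[-> _] /andP[-> _]].
split; last first.
  congr (_, _).
    apply/ffunP => v; rewrite !ffunE; case: (boolP (v \in T)) => // vT.
    by rewrite x0// inE vT.
  apply/setP => -[u v]; rewrite !inE /=.
  case: (boolP ((u, v) \in D)) => [/DT//|_] /=.
  by case: (u \in T) => //=; case: (v \in T); rewrite ?andbF.
rewrite inE; apply/andP; split; last first.
  apply/subsetP => v vT; rewrite inE TS//= ffunE vT inordc eqxx /=.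
  apply/forallP => w; rewrite !inE /= vT /= orbF; apply/negP => /DT.
  by rewrite vT.
apply/compatible_pairsP; split => [||u v].
- apply/coloringsP; split => v; rewrite ffunE => vS.
    case: ifPn => vT; first by rewrite inordc.
    by rewrite xlt// inE vT.
  rewrite ifF; first by apply: x0; rewrite inE negb_and vS orbT.
  by apply: contraNF vS; exact: TS.
- (* a height strictly above every value of y *)
  pose M : R := \sum_v `|y v| + 1.
  have yM v : y v < M.
    rewrite ltr_pwDr//; apply: (le_trans (ler_norm _)).
    by rewrite (bigD1 v)//= lerDl sumr_ge0.
  exists (fun v => if v \in T then M else y v).
    apply/proper_onP => u v uS vS uv.
    case: ifPn => uT; case: ifPn => vT.
    + by have := Tind _ _ uT vT; rewrite uv.
    + by rewrite gt_eqF.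
    + by rewrite lt_eqF.
    + by apply: yS; rewrite ?inE ?uT ?vT.
  apply/setP => -[u v]; rewrite DE !inE /=.
  case: (boolP (u \in T)) => uT /=.
    case: (boolP (v \in T)) => vT; rewrite ?ltxx ?andbF//=.
    by rewrite ltNge (ltW (yM v)) /= !andbF.
  case: (boolP (v \in T)) => vT /=; last by rewrite andbF orbF.
  by rewrite (TS _ vT) (yM u) /= andbF andbT.
- rewrite !inE !ffunE /= => /orP[uv|/and3P[/andP[uT uS] vT _]].
    by have /andP[/negPf-> /negPf->] := DT _ _ uv; exact: xD.
  by rewrite vT (negPf uT) inordc -ltnS xlt// inE uT.
Qed.

(** The recurrence inverse to [proper_countS]. *)
Lemma compatible_pairs_rec m S c : (c <= m)%N ->
  \sum_(T : {set V} | (T \subset S) && independent T)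
     (-1) ^+ #|T| * #|compatible_pairs m (S :\: T) c.+1|%:R =
  #|compatible_pairs m S c|%:R :> rat.
Proof.
move=> cm.
transitivity (\sum_(T : {set V} | (T \subset S) && independent T)
    \sum_(p in compatible_pairs m S c.+1 | T \subset top_sinks S c p)
     (-1) ^+ #|T| : rat).
  apply: eq_bigr => T /andP[TS Ti].
  rewrite -(card_compatible_pairs_sinks cm TS Ti) sumr_const mulr_natr.
  by congr (_ *+ _); apply: eq_card => p; rewrite inE.
rewrite (exchange_big_dep (mem (compatible_pairs m S c.+1)))/=; last by move=> ? ? _ /andP[].
transitivity (\sum_(p in compatible_pairs m S c.+1) (top_sinks S c p == set0)%:R : rat).
  apply: eq_bigr => p pP; rewrite -alternating_sum_subsets; apply: eq_bigl => T.
  rewrite pP /=; apply: andb_idl => TK; apply/andP; split.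
    by apply: (subset_trans TK); apply/subsetP => v; rewrite inE => /andP[].
  have /independentP Ki := top_sinks_independent pP.
  by apply/independentP => u v uT vT; apply: Ki; apply: (subsetP TK).
rewrite -(top_sinks_eq0 S cm) -natr_sum; congr (_%:R).
rewrite -sum1_card [RHS](eq_bigl (fun p =>
  (p \in compatible_pairs m S c.+1) && (top_sinks S c p == set0))).
  by rewrite [RHS]big_mkcondr; apply: eq_bigr => p _; case: eqP.
by move=> p; rewrite inE.
Qed.

Lemma proper_count0 m S : proper_count m S 0 = (S == set0).
Proof.
rewrite /proper_count; have [->|/set0Pn[v vS]] := eqVneq S set0.
  apply/eqP/cards1P; exists [ffun=> ord0]; apply/setP => x; rewrite !inE.
  apply/andP/eqP => [[/forallP x0 _]|->].
    by apply/ffunP => v; have := x0 v; rewrite inE ffunE => /eqP.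
  split; first by apply/forallP => v; rewrite inE ffunE.
  by apply/proper_onP => u v; rewrite inE.
apply/eqP; rewrite cards_eq0; apply/eqP/setP => x; rewrite [LHS]inE [RHS]inE.
by apply/negP => /andP[/coloringsP[/(_ _ vS)]].
Qed.

Lemma card_compatible_pairs0 m S : #|compatible_pairs m S 0| = (S == set0).
Proof.
have [->|/set0Pn[v vS]] := eqVneq S set0; last first.
  apply/eqP; rewrite cards_eq0; apply/eqP/setP => -[x D]; rewrite [RHS]inE.
  by apply/negP => /compatible_pairsP[/coloringsP[/(_ _ vS)]].
have pat0 (y : V -> R) : pattern set0 y = set0 by apply/setP => q; rewrite !inE.
apply/eqP/cards1P; exists ([ffun=> ord0], set0); apply/setP => -[x D].
apply/compatible_pairsP/set1P => [[/coloringsP[_ x0] [y _ ->] _]|[-> ->]].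
  by congr (_, _); [apply/ffunP => v; rewrite x0 ?inE// ffunE|exact: pat0].
split=> [||u v]; last by rewrite inE.
  by apply/coloringsP; split=> v; rewrite inE// ffunE.
by exists (fun=> 0); [apply/proper_onP => u v; rewrite inE|].
Qed.

(** By [proper_countS], the difference in [c] of the number of proper colorings
    of [S] is a sum of such numbers for proper subsets of [S].  The polynomial
    must serve every [m] at once, since its values at all [c] are needed and a
    given [m] allows only [c <= m.+1]. *)
Lemma proper_count_poly S : exists p : {poly rat}, forall m c,
  (c <= m.+1)%N -> p.[c%:R] = (proper_count m S c)%:R.
Proof.
have [k] := ubnP #|S|; elim: k S => // k IH S; rewrite ltnS => Sk.
have /choice[p pE] : forall T : {set V}, exists p : {poly rat},
    T \subset S -> T != set0 -> forall m c,
    (c <= m.+1)%N -> p.[c%:R] = (proper_count m (S :\: T) c)%:R.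
  move=> T; have [TS|] := boolP (T \subset S); last by exists 0.
  have [->|T0] := eqVneq T set0; first by exists 0.
  have [|p pE] := IH (S :\: T); last by exists p.
  by move: Sk T0; rewrite -(cardsID T S) (setIidPr TS) -card_gt0; lia.
pose r := \sum_(T : {set V} | [&& T \subset S, independent T & T != set0]) p T.
have [q qE] := has_antidifferenceP r.
exists (q + (- q.[0] + (S == set0)%:R)%:P) => m c.
rewrite hornerD hornerC.
elim: c => [|c IHc] cm; first by rewrite proper_count0 addrA subrr add0r.
rewrite qE proper_countS// (bigD1 set0) /=; last first.
  by rewrite sub0set; apply/independentP => u v; rewrite inE.
rewrite setD0 natrD -IHc 1?ltnW// addrAC; congr (_ + _).
rewrite horner_sum natr_sum; apply: eq_big => [T|T /and3P[TS _ T0]].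
  by rewrite andbA.
by rewrite (pE T TS T0 m)// ltnW.
Qed.

(** Stanley's theorem.  The recurrence for proper colorings is a polynomial
    identity, so it may be read at -c-1, where it expresses the value at -c-1 for
    [S] by the value at -c for [S] and the values at -c-1 for smaller sets; the
    inverse recurrence expresses the compatible pairs in the same way. *)
Lemma compatible_pairs_reciprocity (p : {set V} -> {poly rat}) :
  (forall S m c, (c <= m.+1)%N -> (p S).[c%:R] = (proper_count m S c)%:R) ->
  forall m c S, (c <= m.+1)%N ->
    #|compatible_pairs m S c|%:R = (-1) ^+ #|S| * (p S).[- c%:R].
Proof.
move=> pE m.
have ind0 : independent set0 by apply/independentP => u v; rewrite inE.
have pS S (x : rat) : (p S).[x + 1] =
    \sum_(T : {set V} | (T \subset S) && independent T) (p (S :\: T)).[x].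
  pose r := p S \Po ('X + 1%:P)
    - \sum_(T : {set V} | (T \subset S) && independent T) p (S :\: T).
  suff r0 : r = 0.
    have := congr1 (fun p => p.[x]) r0.
    rewrite hornerD hornerN horner_comp horner_sum !hornerE => /eqP.
    by rewrite subr_eq0 => /eqP.
  apply: (@poly_eq0_nat _ 0) => c _.
  rewrite hornerD hornerN horner_comp horner_sum !hornerE natr1.
  rewrite (pE _ c)// proper_countS// natr_sum; apply/eqP; rewrite subr_eq0.
  by apply/eqP/eq_bigr => T _; rewrite (pE _ c).
elim=> [|c IHc] S cm.
  rewrite card_compatible_pairs0 oppr0 (pE S m 0%N)// proper_count0.
  by case: eqP => [->|_]; rewrite ?cards0 ?mulr1 ?mulr0.
have [k] := ubnP #|S|; elim: k S => // k IH S; rewrite ltnS => Sk.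
have := @compatible_pairs_rec m S c cm.
rewrite IHc 1?ltnW// -[- c%:R](subrK 1) -opprD natr1 pS.
rewrite (bigD1 set0) ?sub0set//= [in RHS](bigD1 set0) ?sub0set//=.
rewrite setD0 cards0 mul1r mulrDr mulr_sumr => /eqP.
rewrite [X in _ + X](eq_bigr (fun T : {set V} => (-1) ^+ #|S| * (p (S :\: T)).[- c.+1%:R])).
  by move=> /eqP/addIr.
move=> T /andP[/andP[TS _] T0]; rewrite IH.
  by rewrite mulrA -exprD -(cardsID T S) (setIidPr TS).
by move: Sk T0; rewrite -(cardsID T S) (setIidPr TS) -card_gt0; lia.
Qed.

End Colorings.

Local Open Scope classical_set_scope.

Lemma card_fset_set_image (X : finType) (Y : choiceType) (f : X -> Y)
    (A : {set X}) :
  {in A &, injective f} -> #|` fset_set (f @` [set` A])| = #|A|.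
Proof.
move=> finj.
have -> : f @` [set` A] = [set` [fset y in [seq f a | a <- enum A]]%fset].
  apply/seteqP; split=> [_ [a aA <-]|y] /=; rewrite inE.
    by apply: map_f; rewrite mem_enum.
  by case/mapP => a; rewrite mem_enum => aA ->; exists a.
rewrite set_fsetK card_fseq undup_id ?size_map -?cardE//.
rewrite map_inj_in_uniq ?enum_uniq// => a b; rewrite !mem_enum; exact: finj.
Qed.

(** * Regions of the cube *)

Lemma coordB_continuous (R : realType) (n : nat) (u v : 'I_n) :
  continuous (fun x : 'rV[R]_n => x ord0 u - x ord0 v : R).
Proof.
move=> x; apply: (@continuousB _ _ _ (fun x : 'rV[R]_n => x ord0 u : R)
  (fun x => x ord0 v)); exact: coord_continuous.
Qed.

Section Regions.
Variables (R : realType) (n : nat) (adj : rel 'I_n).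
Hypothesis adj_sym : symmetric adj.
Implicit Types (x y : 'rV[R]_n) (D : {set 'I_n * 'I_n}).
Local Notation nodes := (finset.setTfor 'I_n).
Local Notation pattern_of y := (pattern adj nodes (fun i => y ord0 i)).
Local Notation proper_point y := (proper_on adj nodes (fun i => y ord0 i)).
Local Notation U := [set y : 'rV[R]_n | unit_cube R n y /\ proper_point y].

Definition region D : set 'rV[R]_n :=
  [set y | [/\ unit_cube R n y, proper_point y & pattern_of y = D]].

Definition weak_region D : set 'rV[R]_n :=
  [set y | unit_cube R n y /\ forall u v, (u, v) \in D -> y ord0 u <= y ord0 v].

Lemma mem_pattern y u v :
  ((u, v) \in pattern_of y) = adj u v && (y ord0 u < y ord0 v).
Proof. by rewrite !inE. Qed.

Lemma proper_pointP y :
  reflect (forall u v, adj u v -> y ord0 u != y ord0 v) (proper_point y).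
Proof.
by apply: (iffP (proper_onP _ _ _)) => h u v *; apply: h; rewrite ?inE.
Qed.

(** The sets with a prescribed pattern are convex. *)
Lemma segment_pattern y y' (s : R) : 0 <= s <= 1 ->
  proper_point y -> proper_point y' -> pattern_of y = pattern_of y' ->
  proper_point (y + s *: (y' - y)) /\ pattern_of (y + s *: (y' - y)) = pattern_of y.
Proof.
move=> /andP[s0 s1] /proper_pointP yp /proper_pointP yp' pE.
have lt u v : adj u v -> y ord0 u < y ord0 v ->
    (y + s *: (y' - y)) ord0 u < (y + s *: (y' - y)) ord0 v.
  move=> uv yuv; have /setP/(_ (u, v)) := pE.
  rewrite !mem_pattern uv yuv /= => /esym yuv'; rewrite !mxE.
    have [s_lt1|s_ge1] := ltP s 1; last by (have -> : s = 1 by lra); lra.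
    have : 0 < (1 - s) * (y ord0 v - y ord0 u) by rewrite mulr_gt0 ?subr_gt0.
    have : 0 <= s * (y' ord0 v - y' ord0 u) by apply: mulr_ge0 => //; rewrite subr_ge0 ltW.
    by nra.
have gt u v : adj u v -> y ord0 v < y ord0 u ->
    (y + s *: (y' - y)) ord0 v < (y + s *: (y' - y)) ord0 u.
  by rewrite adj_sym; exact: lt.
split.
  apply/proper_pointP => u v uv; have := yp _ _ uv.
  by rewrite !neq_lt => /orP[/(lt _ _ uv) ->//|/(gt _ _ uv) ->]; rewrite orbT.
apply/setP => -[u v]; rewrite !mem_pattern; case: (boolP (adj u v)) => //= uv.
have := yp _ _ uv; rewrite neq_lt => /orP[yuv|yvu].
  by rewrite yuv lt.
by rewrite !ltNge (ltW yvu) (ltW (gt _ _ uv yvu)).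
Qed.

Lemma unit_cube_segment y y' (s : R) : 0 <= s <= 1 ->
  unit_cube R n y -> unit_cube R n y' -> unit_cube R n (y + s *: (y' - y)).
Proof.
move=> /andP[s0 s1] yP yP' i; rewrite !mxE.
by have /andP[? ?] := yP i; have /andP[? ?] := yP' i; apply/andP; split; nra.
Qed.

(** A coordinate difference along an edge does not vanish on a connected subset
    of the complement, so its sign is constant there by the intermediate value
    theorem; conversely the points with the pattern of [y] are joined to [y] by
    segments. *)
Lemma connected_component_region y : U y ->
  connected_component U y = region (pattern_of y).
Proof.
move=> [yP yp]; apply/seteqP; split => z.
  move=> [C [Cy CU /= Cconn] Cz].
  have [zP zp] := CU _ Cz.
  have lt (a b : 'rV[R]_n) (u v : 'I_n) : C a -> C b -> adj u v -> a ord0 u < a ord0 v ->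
      b ord0 u < b ord0 v.
    move=> Ca Cb uv auv; rewrite ltNge; apply/negP => bvu.
    have /connected_intervalP itv := connected_continuous_connected Cconn
      (continuous_subspaceT (@coordB_continuous R n u v)).
    have [|c Cc /eqP] := itv (a ord0 u - a ord0 v) (b ord0 u - b ord0 v)
      (imageP _ Ca) (imageP _ Cb) 0.
      by rewrite subr_le0 subr_ge0 (ltW auv).
    rewrite subr_eq0; apply/negP.
    by have [_ /proper_pointP] := CU _ Cc; apply.
  split=> //; apply/setP => -[u v]; rewrite !mem_pattern.
  by apply/andP/andP => -[uv yuv]; split=> //; [exact: (lt z y)|exact: (lt y z)].
move=> [zP zp zE].
pose g (s : R) := y + s *: (z - y).
have gcont : continuous g.
  move=> s; apply: cvgD; first exact: cvg_cst.
  by apply: cvgZr_tmp; exact: cvg_id.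
have segC := connected_continuous_connected (@segment_connected R 0 1)
  (continuous_subspaceT gcont).
apply: (connected_component_max _ _ segC).
- by exists 0; [rewrite /= in_itv /= lexx ler01|rewrite /g scale0r addr0].
- move=> _ [s /= + <-]; rewrite in_itv /= => s01; split.
    exact: unit_cube_segment.
  by have [] := segment_pattern s01 yp zp (esym zE).
- exists 1; first by rewrite /= in_itv /= lexx ler01.
  by rewrite /g scale1r addrC subrK.
Qed.

Lemma region_nonempty D : D \in patterns adj R nodes -> region D !=set0.
Proof.
rewrite inE => /asboolP[y /proper_onP yp ->].
(* an increasing affine map takes the heights, which lie in [-M, M], into [0, 1] *)
pose M : R := \sum_v `|y v| + 1.
have M0 : 0 < M by rewrite ltr_wpDl// sumr_ge0.
have yM v : - M <= y v <= M.
  rewrite -ler_norml /M (bigD1 v)//= -addrA lerDl addr_ge0//.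
  by rewrite sumr_ge0.
pose z : 'rV[R]_n := \row_i ((y i + M) / (M + M)).
have zlt u v : (z ord0 u < z ord0 v) = (y u < y v).
  by rewrite !mxE ltr_pM2r ?invr_gt0 ?(addr_gt0 M0 M0)// ltrD2r.
exists z; split.
- move=> i; rewrite mxE; have /andP[? ?] := yM i.
  by rewrite divr_ge0 ?ler_pdivrMr ?(addr_gt0 M0 M0)//=; lra.
- apply/proper_pointP => u v uv; rewrite neq_lt !zlt -neq_lt.
  by apply: yp; rewrite ?inE.
- by apply/setP => -[u v]; rewrite mem_pattern zlt !inE.
Qed.

(** A point that satisfies the weak inequalities is approached along the segment
    towards a point of the region: all inequalities become strict at once. *)
Lemma closure_region D : D \in patterns adj R nodes ->
  closure (region D) = weak_region D.
Proof.
move=> /region_nonempty[y [yP yp yD]]; apply/seteqP; split=> x.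
  move=> xc; split=> [i|u v uv].
    apply/andP; split.
      have c : closed [set z : 'rV[R]_n | 0 <= z ord0 i].
        apply: (@closed_comp _ _ (fun z : 'rV[R]_n => z ord0 i : R) [set r | 0 <= r]).
          by move=> ? _; exact: coord_continuous.
        exact: closed_ge.
      apply: c; move: x xc; apply: closure_subset => z [zP _ _].
      by have /andP[] := zP i.
    have c : closed [set z : 'rV[R]_n | z ord0 i <= 1].
      apply: (@closed_comp _ _ (fun z : 'rV[R]_n => z ord0 i : R) [set r | r <= 1]).
        by move=> ? _; exact: coord_continuous.
      exact: closed_le.
    apply: c; move: x xc; apply: closure_subset => z [zP _ _].
    by have /andP[] := zP i.
  have c : closed [set z : 'rV[R]_n | 0 <= z ord0 v - z ord0 u].
    apply: (@closed_comp _ _ (fun z : 'rV[R]_n => z ord0 v - z ord0 u : R) [set r | 0 <= r]).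
      by move=> z _; exact: coordB_continuous.
    exact: closed_ge.
  rewrite -subr_ge0; apply: c; move: x xc; apply: closure_subset => z [_ _ zD] /=.
  by move: uv; rewrite -zD mem_pattern subr_ge0 => /andP[_ /ltW].
move=> [xP xD] B /nbhs_ballP[r /= r0 rB].
(* coordinates in the cube differ by at most 1, so this step moves x by less than r *)
pose s : R := Num.min 1 (r / 2).
have s0 : 0 < s by rewrite lt_min ltr01 divr_gt0.
have s1 : s <= 1 by rewrite ge_min lexx.
have sr : s < r.
  by rewrite gt_min; apply/orP; right; rewrite ltr_pdivrMr// mulr_natr mulr2n ltrDl.
exists (x + s *: (y - x)); split; last first.
  apply: rB; split=> // i j; rewrite (ord1 i) /ball /= !mxE opprD addNKr normrN normrM.
  rewrite gtr0_norm//; apply: le_lt_trans sr; rewrite ler_piMr ?(ltW s0)//.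
  have /andP[? ?] := xP j; have /andP[? ?] := yP j.
  by rewrite ler_norml; apply/andP; split; lra.
have yp' := yp; move/proper_pointP in yp'.
have lt u v : (u, v) \in D ->
    (x + s *: (y - x)) ord0 u < (x + s *: (y - x)) ord0 v.
  move=> uv; have := xD _ _ uv; move: uv; rewrite -yD mem_pattern => /andP[_ yuv] xuv.
  by rewrite !mxE; nra.
have Dadj u v : adj u v -> ((u, v) \in D) || ((v, u) \in D).
  by move=> uv; rewrite -yD !mem_pattern (adj_sym v u) uv -neq_lt; exact: yp'.
split.
- by apply: unit_cube_segment; rewrite ?(ltW s0).
- apply/proper_pointP => u v /Dadj; rewrite neq_lt.
  by case/orP => /lt ->; rewrite ?orbT.
- apply/setP => -[u v]; rewrite mem_pattern; apply/andP/idP => [[uv]|uv].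
    by case/orP: (Dadj _ _ uv) => // /lt /ltW; rewrite leNgt => /negP.
  by split; [move: uv; rewrite -yD mem_pattern => /andP[]|exact: lt].
Qed.

(** A point of the open region determines the pattern, having no ties along
    edges; so regions with the same closure have the same pattern. *)
Lemma weak_region_inj : {in patterns adj R nodes &, injective weak_region}.
Proof.
move=> D D' Dp Dp' E.
suff sub (A B : {set 'I_n * 'I_n}) : A \in patterns adj R nodes ->
    B \in patterns adj R nodes -> weak_region A = weak_region B -> B \subset A.
  by apply/eqP; rewrite finset.eqEsubset !sub.
move=> Ap Bp AB; have [y yA] := region_nonempty Ap.
have : weak_region B y by rewrite -AB -closure_region//; exact: subset_closure.
case: yA => _ /proper_pointP yp <- [_ yB].
apply/fintype.subsetP => -[u v] uv; rewrite mem_pattern.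
have uva : adj u v.
  by move: Bp uv; rewrite inE => /asboolP[z _ ->]; rewrite !inE => /and4P[].
by rewrite uva lt_neqAle yp//= yB.
Qed.

Lemma pattern_of_patterns y : proper_point y -> pattern_of y \in patterns adj R nodes.
Proof. by move=> yp; rewrite inE; apply/asboolP; exists (fun i => y ord0 i). Qed.

Lemma closed_regionsE (H : set (set 'rV[R]_n)) :
  unit_cube R n `\` \bigcup_(h in H) h = U ->
  closed_regions (unit_cube R n) H = weak_region @` [set` patterns adj R nodes].
Proof.
rewrite /closed_regions => ->; apply/seteqP; split=> [_ [y Uy <-]|_ [D /= Dp <-]].
  exists (pattern_of y); first by apply: pattern_of_patterns; case: Uy.
  by rewrite connected_component_region// closure_region// pattern_of_patterns//; case: Uy.
have [y yD] := region_nonempty Dp; have [yP yp yE] := yD.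
by exists y => //; rewrite connected_component_region// yE closure_region.
Qed.

Lemma multiplicityE (H : set (set 'rV[R]_n)) x :
  unit_cube R n `\` \bigcup_(h in H) h = U -> unit_cube R n x ->
  multiplicity (unit_cube R n) H x =
  #|[set D in patterns adj R nodes | [forall q in D, x ord0 q.1 <= x ord0 q.2]]%SET|.
Proof.
move=> HU xP; rewrite /multiplicity mem_set//.
rewrite -(@card_fset_set_image _ _ weak_region); last first.
  move=> D D'; rewrite finset.inE => /andP[Dp _]; rewrite finset.inE => /andP[Dp' _].
  exact: weak_region_inj.
congr (#|` fset_set _|); rewrite closed_regionsE//; apply/seteqP; split.
  move=> _ [[D /= Dp <-] [_ xD]]; exists D => //=; rewrite finset.in_set Dp /=.
  by apply/forall_inP => -[u v]; exact: xD.
move=> _ [D /= + <-]; rewrite finset.in_set => /andP[Dp /forall_inP xD].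
by split; [exists D|split=> // u v; exact: xD].
Qed.

End Regions.

(** * The two counts for a graph *)

Lemma quasipolynomial_poly (p : {poly rat}) :
  quasipolynomial (fun t => p.[t%:~R]).
Proof.
exists (size p), (fun i _ => p`_i); split=> [i|t]; first by exists 1%N.
exact: horner_coef.
Qed.

Lemma quasi_extensionE (f : nat -> nat) (q : int -> rat) :
  quasi_extends f q -> quasi_extension f = q.
Proof.
move=> fq; exact: quasi_extension_unique (xgetI (fun=> 0) fq) fq.
Qed.

Lemma interior_unit_cube (R : realType) (n : nat) :
  (unit_cube R n)° = [set x | forall i, 0 < x ord0 i < 1].
Proof.
apply/seteqP; split=> x.
  move=> /nbhs_ballP[r /= r0 rP] i.
  have near_cube (s : R) : `|s| < r -> 0 <= x ord0 i - s <= 1.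
    move=> sr; have : unit_cube R n (x - const_mx s).
      apply: rP; split=> // k l; rewrite (ord1 k) /ball /= !mxE.
      by rewrite opprB addrC subrK.
    by move=> /(_ i); rewrite !mxE.
  have r2 : `|r / 2| < r by rewrite gtr0_norm; lra.
  have /andP[? _] := near_cube _ r2.
  by have /andP[_ ?] := near_cube (- (r / 2)) ltac:(by rewrite normrN); lra.
move=> x01.
pose Q := [set y : 'rV[R]_n | forall k i, `]0, 1[%classic (y k i)].
suff : nbhs x Q.
  apply: filterS => y Qy i; have := Qy ord0 i.
  by rewrite /= in_itv /= => /andP[/ltW -> /ltW ->].
exists (fun _ _ => `]0, 1[%classic); last by [].
move=> k i /=; rewrite (ord1 k); apply: open_nbhs_nbhs; split.
  exact: interval_open.
by rewrite /= in_itv; exact: x01.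
Qed.

Section GraphCounts.
Variables (R : realType) (n : nat) (G : ordinary_graph n).
Local Notation nodes := (finset.setTfor 'I_n).

Definition adjacent : rel 'I_n :=
  [rel u v | [exists e : edge G, (ends e == (u, v)) || (ends e == (v, u))]].

Lemma adjacent_sym : symmetric adjacent.
Proof. by move=> u v; apply: eq_existsb => e; rewrite orbC. Qed.

Lemma proper_on_adjacent (C : eqType) (x : 'I_n -> C) :
  reflect (forall e : edge G, x (ends e).1 != x (ends e).2)
          (proper_on adjacent nodes x).
Proof.
apply: (iffP (proper_onP _ _ _)) => [h e|h u v _ _ /existsP[e]].
  apply: h; rewrite ?finset.inE//; apply/existsP; exists e.
  by rewrite -surjective_pairing eqxx.
by have := h e => + /orP[]/eqP eE; rewrite eE //= eq_sym.
Qed.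

Lemma arrangement_complement (P : set 'rV[R]_n) :
  P `\` \bigcup_(h in graph_arrangement R G) h =
  [set y | P y /\ proper_on adjacent nodes (fun i => y ord0 i)].
Proof.
apply/seteqP; split=> y [Py yH]; split=> //.
  apply/proper_on_adjacent => e; apply/eqP => ye; apply: yH.
  by exists (hyperplane R (ends e).1 (ends e).2) => //; exists e.
case=> _ [e ->] /= ye.
by have := proper_on_adjacent _ yH e; rewrite ye eqxx.
Qed.

Lemma card_proper_colorings (m c : nat) : (c <= m.+1)%N ->
  #|proper_colorings G c| = proper_count adjacent m nodes c.
Proof.
move=> cm; pose f (x : {ffun 'I_n -> 'I_c}) := [ffun v => widen_ord cm (x v)].
have finj : injective f.
  move=> x y xy; apply/ffunP => v; apply: val_inj.
  by have /ffunP/(_ v) := xy; rewrite !ffunE => /(congr1 val).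
rewrite -(card_imset _ finj); apply: eq_card => x.
rewrite [RHS]finset.inE; apply/imsetP/andP => [[y + ->]|[/coloringsP[xlt _]]].
  rewrite finset.inE => /forallP yp; split.
    by apply/coloringsP; split=> v; rewrite finset.inE// ffunE => _ /=.
  by apply/proper_on_adjacent => e; rewrite !ffunE -val_eqE /= val_eqE.
move=> /proper_on_adjacent xp.
have {}xlt v : (x v < c)%N by apply: xlt; rewrite finset.inE.
exists [ffun v => Ordinal (xlt v)].
  by rewrite finset.inE; apply/forallP => e; rewrite !ffunE -val_eqE /= val_eqE.
by apply/ffunP => v; apply: val_inj; rewrite !ffunE.
Qed.

(** The numerators 1, ..., t - 1 of the coordinates are the colors, shifted by 1
    from ['I_t.-1]. *)
Lemma open_countE (t : nat) : (0 < t)%N ->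
  open_count (unit_cube R n)° (graph_arrangement R G) t =
  #|proper_colorings G t.-1|.
Proof.
move=> t0; have tR : 0 < t%:R :> R by rewrite ltr0n.
have tV : t%:R^-1 != 0 :> R by rewrite invr_eq0 gt_eqF.
pose f (x : {ffun 'I_n -> 'I_t.-1}) : 'rV[R]_n := \row_i (t%:R^-1 * (x i).+1%:R).
have fE x u v : (f x ord0 u == f x ord0 v) = (x u == x v).
  rewrite !mxE (inj_eq (mulfI tV)) eqr_nat eqSS.
  by rewrite -val_eqE.
rewrite -(@card_fset_set_image _ _ f); last first.
  move=> x y _ _ /rowP xy; apply/ffunP => v; apply/val_inj.
  have /eqP := xy v; rewrite !mxE (inj_eq (mulfI tV)).
  by rewrite eqr_nat eqSS => /eqP.
rewrite /open_count arrangement_complement interior_unit_cube.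
congr (#|` fset_set _|); apply/seteqP; split; last first.
  move=> _ [x /= + <-]; rewrite finset.inE => /forallP xp; split; last split.
  - by move=> i; exists (x i).+1%:Z; rewrite mxE.
  - move=> i; rewrite mxE mulr_gt0 ?invr_gt0 ?ltr0n//= mulrC.
    by rewrite ltr_pdivrMr// mul1r ltr_nat -ltn_predRL.
  - by apply/proper_on_adjacent => e; rewrite fE.
move=> y [/= ylat [y01 /proper_on_adjacent yp]].
have zE i : exists k : 'I_t.-1, y ord0 i = t%:R^-1 * k.+1%:R.
  have [z yz] := ylat i; have := y01 i; rewrite yz => /andP[].
  rewrite pmulr_rgt0 ?invr_gt0// mulrC ltr_pdivrMr// mul1r.
  rewrite ltr0z => z0; rewrite -[t%:R]/(t%:Z%:~R) ltr_int => zt.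
  have kt : (`|z|.-1 < t.-1)%N by lia.
  exists (Ordinal kt) => /=; rewrite mulrC prednK; last by lia.
  by rewrite natr_absz gtr0_norm.
have [x xE] := choice zE.
have yE : y = f (finfun x) by apply/rowP => i; rewrite mxE ffunE xE.
exists (finfun x) => //=; rewrite finset.inE; apply/forallP => e.
by rewrite -fE -yE.
Qed.

(** The colors are the numerators 0, ..., t, so there are [t.+1] of them; lattice
    points off the cube have multiplicity 0. *)
Lemma closed_countE (t : nat) : (0 < t)%N ->
  closed_count (unit_cube R n) (graph_arrangement R G) t =
  #|compatible_pairs adjacent R t nodes t.+1|.
Proof.
move=> t0; have tR : 0 < t%:R :> R by rewrite ltr0n.
have tV : t%:R^-1 != 0 :> R by rewrite invr_eq0 gt_eqF.
pose f (x : {ffun 'I_n -> 'I_t.+1}) : 'rV[R]_n := \row_i (t%:R^-1 * (x i)%:R).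
have fle x u v : (f x ord0 u <= f x ord0 v) = (x u <= x v)%N.
  by rewrite !mxE ler_pM2l ?invr_gt0// ler_nat.
have finj : injective f.
  move=> x y /rowP xy; apply/ffunP => v; apply/val_inj.
  have /eqP := xy v; rewrite !mxE (inj_eq (mulfI tV)).
  by rewrite eqr_nat => /eqP.
have fP x : unit_cube R n (f x).
  move=> i; rewrite mxE mulr_ge0 ?invr_ge0 ?ler0n//= mulrC.
  by rewrite ler_pdivrMr// mul1r ler_nat -ltnS.
pose r := [seq f x | x <- enum {: {ffun 'I_n -> 'I_t.+1}}].
rewrite /closed_count -(@fsbig_widen _ _ _ _ [set` r]).
- rewrite -fsbig_seq; last by rewrite map_inj_uniq// enum_uniq.
  rewrite big_map big_enum /=.
  transitivity (\sum_x \sum_(D | (x, D) \in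
      compatible_pairs adjacent R t nodes t.+1) 1)%N; last first.
    by rewrite pair_big_dep -sum1_card; apply: eq_bigl => -[x D].
  apply: eq_bigr => x _; rewrite sum1_card.
  rewrite (multiplicityE adjacent_sym (arrangement_complement _) (fP x)).
  apply: eq_card => D; rewrite finset.inE.
  apply/andP/compatible_pairsP => [[+ /forall_inP xD]|[_ yD xD]].
    rewrite finset.inE => /asboolP yD; split=> //.
      by apply/coloringsP; split=> v; rewrite finset.inE.
    by move=> u v /xD; rewrite fle.
  split; first by rewrite finset.inE; apply/asboolP.
  by apply/forall_inP => -[u v] /xD; rewrite fle.
- by move=> _ /= /mapP[x _ ->] i; exists (x i)%:Z; rewrite mxE.
move=> y [/= ylat yr]; rewrite /multiplicity; case: ifPn => //.
rewrite inE => yP; exfalso; apply: yr.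
have zE i : exists k : 'I_t.+1, y ord0 i = t%:R^-1 * k%:R.
  have [z yz] := ylat i; have := yP i; rewrite yz => /andP[].
  rewrite pmulr_rge0 ?invr_gt0// mulrC ler_pdivrMr// mul1r.
  rewrite ler0z => z0; rewrite -[t%:R]/(t%:Z%:~R) ler_int => zt.
  have kt : (`|z| < t.+1)%N by lia.
  exists (Ordinal kt) => /=; rewrite mulrC.
  by rewrite natr_absz ger0_norm.
have [x xE] := choice zE.
apply/mapP; exists (finfun x); first by rewrite mem_enum.
by apply/rowP => i; rewrite mxE ffunE xE.
Qed.

End GraphCounts.

Unset Implicit Arguments.

Theorem theorem5p1 (R : realType) (n : nat) (G : ordinary_graph n) :
  let P := unit_cube R n in
  let H := graph_arrangement R G in
  [/\ quasi_extends (closed_count P H) (closed_ehrhart P H),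
      quasi_extends (open_count P° H) (open_ehrhart P° H),
      is_chromatic_poly G (chromatic_poly G) &
      forall t : int,
        (-1) ^+ n * closed_ehrhart P H (- t) = open_ehrhart P° H t /\
        open_ehrhart P° H t = (chromatic_poly G).[(t - 1)%:~R]].
Proof.
move=> P H.
have [p pE] := choice (proper_count_poly (adjacent G)).
set chi := p (finset.setTfor 'I_n).
have chiP : is_chromatic_poly G chi.
  by move=> c; rewrite (pE _ c)// (card_proper_colorings _ (leqnSn c)).
have chiE : chromatic_poly G = chi.
  exact: chromatic_poly_unique (xgetI 0 chiP) chiP.
have openE : quasi_extends (open_count P° H) (fun t => chi.[(t - 1)%:~R]).
  split=> [|t t0]; last first.
    by rewrite open_countE// -chiP -subn1 natrB// intrD.
  have := quasipolynomial_poly (chi \Po ('X - 1%:P)); congr quasipolynomial.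
  by apply/funext => t; rewrite horner_comp !hornerE intrD.
have closedE : quasi_extends (closed_count P H)
    (fun t => (-1) ^+ n * chi.[(- t - 1)%:~R]).
  split=> [|t t0]; last first.
    rewrite closed_countE// (compatible_pairs_reciprocity (@adjacent_sym n G) _ pE)//.
    by rewrite cardsT card_ord -natr1 opprD intrD intrN.
  have := quasipolynomial_poly ((-1) ^+ n *: (chi \Po (- 'X - 1%:P))).
  congr quasipolynomial; apply/funext => t.
  by rewrite hornerZ horner_comp !hornerE intrD intrN.
rewrite /closed_ehrhart /open_ehrhart (quasi_extensionE closedE).
rewrite (quasi_extensionE openE) chiE; split=> // t; split=> //.
by rewrite opprK mulrA -expr2 sqrr_sign mul1r.
Qed.
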